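(* Let $m,N\ge 1$, let $f\in C_0^\infty(\mathbb{R}^m)$, and let $$B_N(f)(x)=\sum_{\alpha\in\mathbb{N}^m:\,|\alpha|\le N}\binom{N}{\alpha}x^\alpha(1-\|x\|)^{N-|\alpha|}f\Big(\frac{\alpha}{N}\Big)$$ be the classical Bernstein polynomial on the simplex $\Sigma_m=\{x\in\mathbb{R}^m: x_j\ge 0,\ \|x\|:=\sum_{j}x_j\le 1\}$. Then for every $x\in\Sigma_m$, $$B_N(f)(x)=\frac{1}{\Pi_{h_{FS}^N}(z,z)}\,f(N^{-1}D_\theta)\,\Pi_{h_{FS}^N}(e^{i\theta}z,z)\Big|_{\theta=0,\ z=\mu_{h_{FS}}^{-1}(x)},$$ where $\Pi_{h_{FS}^N}$ is the Bergman–Szegő kernel of the $N$th power $\mathcal{O}(N)\to\mathbb{CP}^m$ of the hyperplane bundle with the Fubini–Study metric, and $\mu_{h_{FS}}$ is the Fubini–Study moment map.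
   Context: Here $|\alpha|=\alpha_1+\dots+\alpha_m$, $\binom{N}{\alpha}=\frac{N!}{(N-|\alpha|)!\,\alpha_1!\cdots\alpha_m!}$, $x^\alpha=x_1^{\alpha_1}\cdots x_m^{\alpha_m}$ (with $0^0=1$). $H^0(\mathbb{CP}^m,\mathcal{O}(N))$ is identified with homogeneous polynomials of degree $N$ in $\zeta=(\zeta_0,\dots,\zeta_m)$, restricted to the unit sphere $S^{2m+1}\subset\mathbb{C}^{m+1}$; in the affine chart the monomial $z^\alpha$, $|\alpha|\le N$, corresponds to $\hat\chi_\alpha(\zeta)=\zeta_0^{N-|\alpha|}\zeta_1^{\alpha_1}\cdots\zeta_m^{\alpha_m}$. The monomials are orthogonal for the Fubini–Study inner product, with $\|\chi_\alpha\|^2=\frac{(N-|\alpha|)!\,\alpha_1!\cdots\alpha_m!}{(N+m)!}$. The Bergman–Szegő kernel $\Pi_{h_{FS}^N}$ is the kernel of the orthogonal projection onto $H^0(\mathbb{CP}^m,\mathcal{O}(N))$; lifted to the sphere it is $$\Pi_{h_{FS}^N}(\zeta,\eta)=\sum_{|\alpha|\le N}\frac{\hat\chi_\alpha(\zeta)\overline{\hat\chi_\alpha(\eta)}}{\|\chi_\alpha\|^2},\qquad \zeta,\eta\in S^{2m+1}.$$ A point $z\in\mathbb{CP}^m$ is represented by a unit vector $\zeta$ above it; the values used in the claim do not depend on this choice. The torus $\mathbf{T}^m=(S^1)^m$ acts by $e^{i\theta}\cdot(\zeta_0,\zeta_1,\dots,\zeta_m)=(\zeta_0,e^{i\theta_1}\zeta_1,\dots,e^{i\theta_m}\zeta_m)$,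 and $D_{\theta_j}$ ($1\le j\le m$) is $\frac1i$ times the infinitesimal generator of the $j$th circle acting on $H^0(\mathbb{CP}^m,\mathcal{O}(N))$, i.e. $D_{\theta_j}\hat\chi_\alpha=\alpha_j\hat\chi_\alpha$; equivalently it acts on the function $\theta\mapsto \Pi_{h_{FS}^N}(e^{i\theta}z,z)$ as $\frac1i\frac{\partial}{\partial\theta_j}$. The operator $f(N^{-1}D_\theta)$ is defined by the spectral theorem for the commuting operators $N^{-1}D_{\theta_1},\dots,N^{-1}D_{\theta_m}$ (equivalently $f(N^{-1}D_\theta)=\int_{\mathbb{R}^m}\hat f(\xi)e^{i\langle\xi,N^{-1}D_\theta\rangle}d\xi$ with $\hat f$ normalized so that $f(y)=\int\hat f(\xi)e^{i\langle \xi,y\rangle}d\xi$). The moment map $\mu_{h_{FS}}:\mathbb{CP}^m\to\Sigma_m$ is $\mu_{h_{FS}}(z)=\big(\frac{|z_1|^2}{1+\|z\|^2},\dots,\frac{|z_m|^2}{1+\|z\|^2}\big)$ in the affine chart, i.e. $\mu_{h_{FS}}([\zeta])=(|\zeta_1|^2,\dots,|\zeta_m|^2)$ for $|\zeta|=1$; $z=\mu_{h_{FS}}^{-1}(x)$ means any point $z$ with $\mu_{h_{FS}}(z)=x$ (the expression is constant on torus orbits). *)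

(* Defs.v *)
From HB Require Import structures.
From mathcomp Require Import all_boot all_order all_algebra.
From mathcomp Require Import complex.
From mathcomp Require Import all_classical all_reals all_analysis.

Set Implicit Arguments.
Unset Strict Implicit.
Unset Printing Implicit Defensive.

Import Order.TTheory GRing.Theory Num.Theory.
Import numFieldNormedType.Exports.

Local Open Scope classical_set_scope.
Local Open Scope complex_scope.
Local Open Scope ring_scope.

Section TestFunctions.
Context {R : realType} {m : nat}.

Fixpoint Ck (k : nat) (g : 'rV[R]_m -> R) : Prop :=
  continuous g /\
  match k with
  | 0%N => True
  | k'.+1 => forall j : 'I_m,
      (forall x, derivable g x (delta_mx 0 j)) /\
      Ck k' (fun x => 'D_(delta_mx 0 j) g x)
  end.

Definition smooth (g : 'rV[R]_m -> R) : Prop := forall k, Ck k g.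

(* Complex-valued test functions; real-valued ones are those with vanishing imaginary part. *)
Definition test_function (f : 'rV[R]_m -> R[i]) : Prop :=
  [/\ smooth (fun x => complex.Re (f x)), smooth (fun x => complex.Im (f x)) &
      compact (closure [set x | f x != 0])].

End TestFunctions.

(* The joint functional calculus of a commuting family A of self-adjoint
   operators on a finite-dimensional space H of functions, with inner product
   ip (linear in the first variable). *)
Section FunctionalCalculus.
Context {R : realType} {T : Type} {m : nat}.
Let E := T -> R[i].
Variables (ip : E -> E -> R[i]) (H : set E) (A : 'I_m -> E -> E).

Definition is_orth_proj (W : set E) (s p : E) : Prop :=
  W p /\ forall w, W w -> ip (fun z => s z - p z) w = 0.

Definition orth_proj (W : set E) (s : E) : E :=
  xget (fun=> 0) [set p | is_orth_proj W s p].

Definition joint_eigenspace (lam : 'rV[R]_m) : set E :=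
  [set s | H s /\ forall j z, A j s z = (lam 0 j)%:C * s z].

Definition joint_spectrum : set 'rV[R]_m :=
  [set lam | exists2 s, joint_eigenspace lam s & exists z, s z != 0].

(* f(A) = sum over the joint spectrum of f(lam) times the spectral projection
   at lam. The sum has finite support because H is finite-dimensional. *)
Definition functional_calculus (f : 'rV[R]_m -> R[i]) (s : E) : E := fun z =>
  \sum_(lam \in joint_spectrum)
     f lam * orth_proj (joint_eigenspace lam) s z.

End FunctionalCalculus.

Section FubiniStudy.
Context {R : realType}.
Variables m N : nat.

(* Multi-indices alpha with |alpha| <= N have all their entries <= N, so they
   are the a : {ffun 'I_m -> 'I_N.+1} with (msum a <= N)%N. *)
Definition multi_index := {ffun 'I_m -> 'I_N.+1}.

Definition msum (a : multi_index) : nat := (\sum_(j < m) a j)%N.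

Definition mfact (a : multi_index) : nat := (\prod_(j < m) (a j)`!)%N.

(* Points of C^(m+1); coordinate 0 is zeta_0, coordinate lift ord0 j is
   zeta_(j+1) for j : 'I_m. *)
Definition point := 'rV[R[i]]_m.+1.

Definition section := point -> R[i].

Definition unit_sphere : set point :=
  [set z | \sum_(k < m.+1) `|z 0 k| ^+ 2 = 1].

Definition monomial (a : multi_index) : section := fun z =>
  z 0 ord0 ^+ (N - msum a) * \prod_(j < m) z 0 (lift ord0 j) ^+ a j.

Definition lin_comb (c : multi_index -> R[i]) : section := fun z =>
  \sum_(a : multi_index | (msum a <= N)%N) c a * monomial a z.

(* H^0(CP^m, O(N)): homogeneous polynomials of degree N on C^(m+1). *)
Definition H0 : set section := range lin_comb.

Definition mono_coef (s : section) : multi_index -> R[i] :=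
  xget (fun=> 0) [set c | s = lin_comb c].

Definition fs_norm2 (a : multi_index) : R[i] :=
  ((N - msum a)`! * mfact a)%:R / (N + m)`!%:R.

(* The Fubini-Study inner product on H0, determined by its values on the
   orthogonal basis of monomials. *)
Definition fs_inner (s t : section) : R[i] :=
  \sum_(a : multi_index | (msum a <= N)%N)
     mono_coef s a * (mono_coef t a)^* * fs_norm2 a.

(* K is the kernel of the orthogonal projection P onto H0, i.e. <s, K(., w)> is
   the value of P s at w. Since K(., w) lies in H0, this pairing ignores the
   component of s orthogonal to H0, so it is enough to test it on s in H0, where
   P s = s. The explicit form of K is bergman_kernelE below. *)
Definition is_bergman_kernel (K : point -> point -> R[i]) : Prop :=
  forall w : point, H0 (fun z => K z w) /\
    forall s : section, H0 s -> fs_inner s (fun z => K z w) = s w.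

Definition bergman_kernel : point -> point -> R[i] :=
  xget (fun _ _ => 0) [set K | is_bergman_kernel K].

Definition expi (t : R) : R[i] := (cos t) +i* (sin t).

Definition torus_act (theta : 'rV[R]_m) (z : point) : point :=
  \row_(k < m.+1)
     (oapp (fun j => expi (theta 0 j)) 1 (unlift ord0 k) * z 0 k).

Definition cderive (u : R -> R[i]) (t : R) : R[i] :=
  (derive1 (fun r => complex.Re (u r)) t)
    +i* (derive1 (fun r => complex.Im (u r)) t).

(* (1/i) times the infinitesimal generator of the j-th circle. *)
Definition Dtheta (j : 'I_m) (s : section) : section := fun z =>
  (0 +i* 1)^-1 * cderive (fun t => s (torus_act (t *: delta_mx 0 j) z)) 0.

Definition f_of_Dtheta (f : 'rV[R]_m -> R[i]) (s : section) : section :=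
  functional_calculus fs_inner H0
    (fun j s' z => N%:R^-1 * Dtheta j s' z) f s.

(* The moment map on unit vectors. *)
Definition moment_map (z : point) : 'rV[R]_m :=
  \row_(j < m) complex.Re (`|z 0 (lift ord0 j)| ^+ 2).

End FubiniStudy.

Section Bernstein.
Context {R : realType}.
Variables m N : nat.

Definition simplex : set 'rV[R]_m :=
  [set x | (forall j, 0 <= x 0 j) /\ \sum_(j < m) x 0 j <= 1].

Definition multinomial (a : multi_index m N) : R :=
  N`!%:R / ((N - msum a)`! * mfact a)%:R.

Definition bernstein (f : 'rV[R]_m -> R[i]) (x : 'rV[R]_m) : R[i] :=
  \sum_(a : multi_index m N | (msum a <= N)%N)
     (multinomial a * (\prod_(j < m) x 0 j ^+ a j)
        * (1 - \sum_(j < m) x 0 j) ^+ (N - msum a))%:C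
     * f (\row_(j < m) ((a j)%:R / N%:R)).

End Bernstein.

Arguments bergman_kernel {R} m N.

Section BergmanKernelFormula.
Context {R : realType}.
Variables m N : nat.

Let digits_inj (B n : nat) (f g : 'I_n -> nat) :
  (forall j, (f j < B)%N) -> (forall j, (g j < B)%N) ->
  (\sum_(j < n) f j * B ^ j = \sum_(j < n) g j * B ^ j)%N -> f =1 g.
Proof.
elim: n f g => [|n IH] f g fB gB; first by move=> _ [].
have E (h : 'I_n.+1 -> nat) : (\sum_(j < n.+1) h j * B ^ j =
    (\sum_(j < n) h (lift ord0 j) * B ^ j) * B + h ord0)%N.
  rewrite big_ord_recl /= expn0 muln1 addnC big_distrl /=; congr (_ + _)%N.
  by apply: eq_bigr => j _; rewrite /bump /= add1n expnSr mulnA.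
rewrite !E => eqs.
have B0 : (0 < B)%N by apply: leq_ltn_trans (fB ord0).
have e0 : f ord0 = g ord0.
  by have := congr1 (modn^~ B) eqs; rewrite !modnMDl !modn_small.
have e1 : forall j, f (lift ord0 j) = g (lift ord0 j).
  apply: IH => //; have := congr1 (divn^~ B) eqs.
  by rewrite !divnMDl // !divn_small // !addn0.
by move=> j; case: (unliftP ord0 j) => [k|] ->.
Qed.

Let lin_comb_inj (c d : multi_index m N -> R[i]) : lin_comb c = lin_comb d ->
  forall a, (msum a <= N)%N -> c a = d a.
Proof.
move=> cd.
pose e (a : multi_index m N) := (\sum_(j < m) a j * N.+1 ^ j)%N.
have e_inj : injective e.
  move=> a b eab; apply/ffunP => j; apply: val_inj.
  by apply: (@digits_inj N.+1 m (fun j => a j) (fun j => b j)) => // k;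
    exact: ltn_ord.
pose q (c : multi_index m N -> R[i]) : {poly R[i]} :=
  \sum_(a : multi_index m N | (msum a <= N)%N) c a *: 'X^(e a).
have qE c' t : (q c').[t] = lin_comb c'
    (\row_k (if unlift ord0 k is Some j then t ^+ (N.+1 ^ j) else 1)).
  rewrite /q horner_sum; apply: eq_bigr => a _.
  rewrite hornerZ hornerXn /monomial mxE unlift_none expr1n mul1r /e -prodrXr.
  congr (_ * _); apply: eq_bigr => j _.
  by rewrite mxE liftK -exprM mulnC.
have qcd : q c = q d.
  apply/eqP; rewrite -subr_eq0; apply: contraTT isT => nz.
  pose rs := [seq (i%:R : R[i]) | i <- iota 0 (size (q c - q d)%R)].
  have : (size rs < size (q c - q d)%R)%N.
    apply: max_poly_roots => //.
      by apply/allP => x _; rewrite rootE hornerD hornerN !qE cd subrr.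
    rewrite map_inj_uniq ?iota_uniq // => i j /eqP.
    by rewrite eqr_nat => /eqP.
  by rewrite size_map size_iota ltnn.
move=> a aN; have := congr1 (fun p : {poly _} => p`_(e a)) qcd.
suff coefq c' : (q c')`_(e a) = c' a by rewrite !coefq.
rewrite /q coef_sum (bigD1 a) //= coefZ coefXn eqxx mulr1 big1 ?addr0 //.
by move=> b /andP[_ ba]; rewrite coefZ coefXn (inj_eq e_inj) eq_sym (negbTE ba)
  mulr0.
Qed.

Let mono_coefE (c : multi_index m N -> R[i]) a :
  (msum a <= N)%N -> mono_coef (lin_comb c) a = c a.
Proof.
move=> aN; rewrite /mono_coef; case: xgetP => [d _ /= cd|].
  by apply/esym; exact: lin_comb_inj cd _ aN.
by move=> /(_ c) /=.
Qed.

Lemma bergman_kernelE (z w : point m) :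
  bergman_kernel m N z w = \sum_(a : multi_index m N | (msum a <= N)%N)
    monomial a z * (monomial a w)^* / fs_norm2 a :> R[i].
Proof.
have n0 (a : multi_index m N) : fs_norm2 a != 0 :> R[i].
  rewrite /fs_norm2 mulf_neq0 ?invr_neq0 // pnatr_eq0 -lt0n ?fact_gt0 //.
  by rewrite muln_gt0 fact_gt0 prodn_gt0 // => j; rewrite fact_gt0.
have nC (a : multi_index m N) : (fs_norm2 a : R[i])^* = fs_norm2 a.
  by rewrite /fs_norm2 rmorphM fmorphV !rmorph_nat.
pose d (w : point m) (a : multi_index m N) : R[i] :=
  (monomial a w)^* / fs_norm2 a.
have dC u a : (d u a)^* = monomial a u / fs_norm2 a.
  by rewrite /d rmorphM fmorphV /= conjCK nC.
pose K0 z w : R[i] := lin_comb (d w) z.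
have K0P : is_bergman_kernel N K0.
  move=> u; split; first by exists (d u).
  move=> s [c _ <-]; apply: eq_bigr => a aN.
  by rewrite !mono_coefE // dC mulrA divfK.
have -> : bergman_kernel m N z w = K0 z w.
  have [K KP ->] : exists2 K, is_bergman_kernel N K & bergman_kernel m N = K :> (_ -> _ -> R[i]).
    by exists (bergman_kernel m N) => //; apply: (xgetI _ K0P).
  have [[c _ cK] rep] := KP w.
  have -> : K z w = lin_comb c z by rewrite (congr1 (@^~ z) cK).
  apply: eq_bigr => a aN; congr (_ * _).
  pose delta (b : multi_index m N) : R[i] := (b == a)%:R.
  have := rep (lin_comb delta) (ex_intro2 _ _ delta I erefl).
  rewrite -cK /fs_inner (bigD1 a) //= [X in _ + X]big1; last first.
    by move=> b /andP[bN /negbTE ba]; rewrite mono_coefE // /delta ba !mul0r.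
  rewrite !mono_coefE // /delta eqxx mul1r addr0.
  rewrite {1}/lin_comb (bigD1 a) //= eqxx mul1r big1 ?addr0; last first.
    by move=> b /andP[_ /negbTE ->]; rewrite mul0r.
  move=> ca; apply: (can_inj (@conjCK _)).
  by rewrite [RHS]dC -ca mulfK.
by apply: eq_bigr => a _; rewrite mulrC mulrA.
Qed.

End BergmanKernelFormula.

Arguments f_of_Dtheta {R m} N.
Arguments bernstein {R m} N.
Arguments unit_sphere {R} m.
Arguments simplex {R} m.

Lemma moment_map_surj (R : realType) (m : nat) (x : 'rV[R]_m) :
  simplex m x -> exists2 z, unit_sphere m z & moment_map z = x.
Proof.
move=> [x0 x1].
pose y (k : 'I_m.+1) :=
  if unlift ord0 k is Some j then x 0 j else 1 - \sum_(j < m) x 0 j.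
have y0 k : 0 <= y k by rewrite /y; case: unlift => [j|] //; rewrite subr_ge0.
pose z : 'rV[R[i]]_m.+1 := \row_k (Num.sqrt (y k))%:C.
have zE k : `|z 0 k| ^+ 2 = (y k)%:C.
  rewrite mxE ger0_norm ?lecR ?sqrtr_ge0 //.
  by rewrite -[RHS](congr1 (@real_complex R) (sqr_sqrtr (y0 k))) rmorphXn.
exists z.
  rewrite /unit_sphere /= (eq_bigr (fun k => real_complex R (y k))) => [|k _].
    rewrite -rmorph_sum big_ord_recl /y unlift_none.
    rewrite [X in _ + X](eq_bigr (fun j => x 0 j)) => [|j _]; last by rewrite liftK.
    by rewrite subrK rmorph1.
  exact: zE.
by apply/rowP => j; rewrite mxE zE /y liftK.
Qed.

(* Main.v *)
From HB Require Import structures.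
From mathcomp Require Import all_boot all_order all_algebra.
From mathcomp Require Import complex.
From mathcomp Require Import all_classical all_reals all_analysis.
From mathcomp Require Import ring.
Require Import Defs.

(** Every monomial [chi_a] is a joint eigenvector of the operators
    [N^-1 D_theta_j], with joint eigenvalue [a/N] ([Dtheta_lin_comb]).
    Distinct multi-indices have distinct eigenvalues, so each joint eigenspace
    is the line through one monomial, the joint spectrum is the set of lattice
    points [a/N] with [|a| <= N], and the spectral theorem says that
    [f(N^-1 D_theta)] multiplies the coefficient of [chi_a] by [f(a/N)]
    ([f_of_Dtheta_lin_comb]).  Since
    [Pi(w,z) = sum_a chi_a(w) conj(chi_a(z)) / ||chi_a||^2], on the diagonal
    this gives [sum_a f(a/N) |chi_a(z)|^2 / ||chi_a||^2].

    If [x] is the moment map image of the unit vector [z], then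
    [|z_0|^2 = 1 - ||x||] and the other [|z_j|^2] are the coordinates of [x];
    hence [|chi_a(z)|^2 / ||chi_a||^2] is [(N+m)!/N!] times the Bernstein weight
    of [a] at [x] ([fs_density_moment_map]).  These weights add up to 1 by the
    multinomial theorem ([multinomial_theorem]), so
    [Pi(z,z) = (N+m)!/N!], and dividing by it leaves the Bernstein
    polynomial. *)

Set Implicit Arguments.
Unset Strict Implicit.
Unset Printing Implicit Defensive.

Import Order.TTheory GRing.Theory Num.Theory.
Import numFieldNormedType.Exports.

Local Open Scope classical_set_scope.
Local Open Scope complex_scope.
Local Open Scope ring_scope.

(** * The multinomial theorem *)

Section MultinomialTheorem.
Context {F : numFieldType}.

(** [p] agrees modulo ['X^B] with the exponential series of [s 'X]. *)
Definition exp_coefs (B : nat) (p : {poly F}) (s : F) :=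
  forall n, (n < B)%N -> p`_n = s ^+ n / n`!%:R.

Lemma exp_coefs_poly B s : exp_coefs B (\poly_(n < B) (s ^+ n / n`!%:R)) s.
Proof. by move=> n nB; rewrite coef_poly nB. Qed.

Lemma exp_coefs1 B : exp_coefs B 1 0.
Proof.
move=> n _; rewrite coef1 expr0n; case: n => [|n] /=; last by rewrite mul0r.
by rewrite fact0 divr1.
Qed.

(** The functional equation [exp (s 'X) * exp (t 'X) = exp ((s + t) 'X)]:
    coefficient by coefficient, it is the binomial theorem. *)
Lemma exp_coefsM B p q s t :
  exp_coefs B p s -> exp_coefs B q t -> exp_coefs B (p * q) (s + t).
Proof.
move=> ps qt n nB; rewrite coefM exprDn_comm ?mulr_suml; last exact: mulrC.
rewrite [RHS](reindex_inj rev_ord_inj) /=.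
apply: eq_bigr => -[i /= iSn] _; rewrite subSS.
have iB : (i < B)%N by exact: leq_trans iSn nB.
rewrite ps // qt ?(leq_ltn_trans (leq_subr _ _)) // subKn // bin_sub //.
have <- : ('C(n, i) * (i`! * (n - i)`!))%N = n`! by rewrite bin_fact.
rewrite -[_ *+ 'C(n, i)]mulr_natr !natrM.
have fn0 k : k`!%:R != 0 :> F by rewrite pnatr_eq0 -lt0n fact_gt0.
have bn0 : 'C(n, i)%:R != 0 :> F by rewrite pnatr_eq0 -lt0n bin_gt0.
by field; rewrite !fn0 bn0.
Qed.

(** Compare the coefficients of ['X^N] in the product of the exponential series
    of [y0 'X] and of the [y j 'X]: expanding the product gives a sum over
    multi-indices, and the functional equation gives the [N]-th power. *)
Lemma multinomial_theorem m N (y0 : F) (y : 'I_m -> F) :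
  \sum_(a : multi_index m N | (msum a <= N)%N)
     N`!%:R / ((N - msum a)`! * mfact a)%:R
     * ((\prod_(j < m) y j ^+ a j) * y0 ^+ (N - msum a))
  = (y0 + \sum_(j < m) y j) ^+ N.
Proof.
pose e s : {poly F} := \poly_(n < N.+1) (s ^+ n / n`!%:R).
have E : exp_coefs N.+1 ((\prod_(j < m) e (y j)) * e y0) (\sum_(j < m) y j + y0).
  apply: exp_coefsM; last exact: exp_coefs_poly.
  elim/big_ind2: _ => [|p s q t|j _]; [exact: exp_coefs1|exact: exp_coefsM|].
  exact: exp_coefs_poly.
have fn0 k : k`!%:R != 0 :> F by rewrite pnatr_eq0 -lt0n fact_gt0.
rewrite addrC -[RHS](divfK (fn0 N)) -(E N) //.
have eE s : e s = \sum_(n < N.+1) (s ^+ n / n`!%:R) *: 'X^n by rewrite /e poly_def.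
rewrite (eq_bigr _ (fun j _ => eE (y j))).
rewrite bigA_distr_bigA mulr_suml coef_sum mulr_suml /=.
rewrite [RHS](bigID (fun a : multi_index m N => (msum a <= N)%N)) /=.
have coefE (a : multi_index m N) :
    ((\prod_(j < m) ((y j ^+ a j / (a j)`!%:R) *: 'X^(a j))) * e y0)`_N =
    if (msum a <= N)%N then
      (\prod_(j < m) y j ^+ a j) / (mfact a)%:R
        * (y0 ^+ (N - msum a) / (N - msum a)`!%:R) else 0.
  rewrite scaler_prod prodrXr -scalerAl coefZ coefXnM /msum ltnNge.
  case: leqP => // aN /=; last by rewrite mulr0.
  rewrite coef_poly ltnS leq_subr prodf_div /mfact natr_prod.
  by [].
rewrite [X in _ + X]big1 ?addr0 => [|a /negbTE aN]; last first.
  by rewrite coefE aN mul0r.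
apply: eq_bigr => a aN; rewrite coefE aN natrM.
have mf0 : (mfact a)%:R != 0 :> F.
  by rewrite pnatr_eq0 -lt0n prodn_gt0 // => j; rewrite fact_gt0.
by field; rewrite fn0 mf0.
Qed.

End MultinomialTheorem.

(** * Derivatives of complex-valued functions of a real variable *)

Section ComplexDerivative.
Context {R : realType}.
Implicit Types (u v : R -> R[i]) (t : R).

Definition is_cderive u t (d : R[i]) :=
  is_derive t 1 (fun r => complex.Re (u r)) (complex.Re d) /\
  is_derive t 1 (fun r => complex.Im (u r)) (complex.Im d).

Lemma is_cderive_val u t d : is_cderive u t d -> cderive u t = d.
Proof.
move=> [ud vd]; rewrite /cderive !derive1E !derive_val.
by case: d {ud vd}.
Qed.

Lemma ReD (x y : R[i]) : complex.Re (x + y) = complex.Re x + complex.Re y.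
Proof. by case: x y => ? ? []. Qed.

Lemma ImD (x y : R[i]) : complex.Im (x + y) = complex.Im x + complex.Im y.
Proof. by case: x y => ? ? []. Qed.

Lemma ReM (x y : R[i]) : complex.Re (x * y) =
  complex.Re x * complex.Re y - complex.Im x * complex.Im y.
Proof. by case: x y => ? ? []. Qed.

Lemma ImM (x y : R[i]) : complex.Im (x * y) =
  complex.Re x * complex.Im y + complex.Im x * complex.Re y.
Proof. by case: x y => ? ? []. Qed.

Lemma is_cderive_cst c t : is_cderive (fun=> c) t 0.
Proof. by split; exact: is_derive_cst. Qed.

Lemma is_cderiveD u v t d e : is_cderive u t d -> is_cderive v t e ->
  is_cderive (fun r => u r + v r) t (d + e).
Proof.
move=> [u1 u2] [v1 v2]; rewrite /is_cderive ReD ImD; split.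
  by under eq_fun do rewrite ReD; exact: is_deriveD.
by under eq_fun do rewrite ImD; exact: is_deriveD.
Qed.

Lemma is_cderiveM u v t d e : is_cderive u t d -> is_cderive v t e ->
  is_cderive (fun r => u r * v r) t (u t * e + v t * d).
Proof.
move=> [u1 u2] [v1 v2]; rewrite /is_cderive ReD ImD !ReM !ImM; split.
  under eq_fun do rewrite ReM.
  apply: is_derive_eq (is_deriveB (is_deriveM u1 v1) (is_deriveM u2 v2)) _.
  by rewrite /GRing.scale /=; ring.
under eq_fun do rewrite ImM.
apply: is_derive_eq (is_deriveD (is_deriveM u1 v2) (is_deriveM u2 v1)) _.
by rewrite /GRing.scale /=; ring.
Qed.

Lemma is_cderive_sum I (s : seq I) (P : pred I) (u : I -> R -> R[i]) t d :
  (forall i, P i -> is_cderive (u i) t (d i)) ->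
  is_cderive (fun r => \sum_(i <- s | P i) u i r) t (\sum_(i <- s | P i) d i).
Proof.
move=> ud; elim: s => [|i s IH].
  by under eq_fun do rewrite big_nil; rewrite big_nil; exact: is_cderive_cst.
under eq_fun do rewrite big_cons; rewrite big_cons; case: ifP => // Pi.
by apply: is_cderiveD IH; exact: ud.
Qed.

Lemma expi0 : expi 0 = 1 :> R[i].
Proof. by rewrite /expi cos0 sin0. Qed.

Lemma is_cderive_expiX n :
  is_cderive (fun r : R => expi r ^+ n) 0 ((0 +i* 1) * n%:R).
Proof.
elim: n => [|n IH]; first by rewrite mulr0; exact: is_cderive_cst.
have De : is_cderive (@expi R) 0 (0 +i* 1).
  split => /=.
    by apply: is_derive_eq (is_derive_cos 0) _; rewrite sin0 oppr0.
  by apply: is_derive_eq (is_derive_sin 0) _; rewrite cos0.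
under eq_fun do rewrite exprS.
have := is_cderiveM De IH; rewrite expi0 expr1n !mul1r -natr1 mulrDr mulr1.
exact.
Qed.

End ComplexDerivative.

(** * The torus action on homogeneous polynomials *)

Section TorusAction.
Context {R : realType} {m N : nat}.
Implicit Types (a b : multi_index m N) (c d : multi_index m N -> R[i]).
Implicit Types (z w : point (R := R) m).

Local Notation monomial := (@monomial R m N).
Local Notation lin_comb := (@lin_comb R m N).

Lemma torus_act0 z : torus_act 0 z = z.
Proof.
apply/rowP => k; rewrite mxE; case: unlift => [j|] /=; last by rewrite mul1r.
by rewrite mxE expi0 mul1r.
Qed.

Lemma monomial_torus_act a t j z :
  monomial a (torus_act (t *: delta_mx 0 j) z) = expi t ^+ a j * monomial a z.
Proof.
rewrite /monomial mxE unlift_none mul1r mulrCA; congr (_ * _).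
rewrite (bigD1 j) //= [in RHS](bigD1 j) //= mulrA; congr (_ * _).
  by rewrite !mxE liftK /= !mxE !eqxx mulr1 exprMn.
apply: eq_bigr => k kj.
by rewrite !mxE liftK /= !mxE (negbTE kj) mulr0 expi0 mul1r.
Qed.

(** The [j]-th circle multiplies [monomial a] by [expi t ^+ a j], whose
    derivative at [0] is ['i * a j]. *)
Lemma Dtheta_lin_comb j c :
  Dtheta j (lin_comb c) = lin_comb (fun a => (a j)%:R * c a).
Proof.
apply/funext => z; rewrite /Dtheta.
have i0 : (0 +i* 1) != 0 :> R[i] by rewrite eq_complex /= oner_eq0 andbF.
rewrite (@is_cderive_val _ _ _ ((0 +i* 1) * lin_comb (fun a => (a j)%:R * c a) z)).
  by rewrite mulKf.
rewrite /Defs.lin_comb mulr_sumr; apply: is_cderive_sum => a _.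
under eq_fun do rewrite monomial_torus_act mulrCA.
have := is_cderiveM (is_cderive_expiX (a j)) (is_cderive_cst (c a * monomial a z) 0).
by rewrite mulr0 add0r; congr is_cderive; ring.
Qed.

(** Monomials are linearly independent because their joint eigenvalues under
    the [Dtheta j] differ.  A product of operators [Dtheta j - k] that kills
    every monomial except [monomial a], applied to a vanishing combination,
    leaves a nonzero multiple of [c a * monomial a], which must then vanish. *)
Lemma lin_comb_eq0 c : lin_comb c = (fun=> 0) ->
  forall a, (msum a <= N)%N -> c a = 0.
Proof.
move=> c0 a aN.
(* The factor by which the product of the [Dtheta p.1 - p.2], for [p] in [s],
   multiplies [monomial b]. *)
pose q (s : seq ('I_m * 'I_N.+1)) b : R[i] :=
  \prod_(p <- s) ((b p.1)%:R - p.2%:R).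
have q0 s : lin_comb (fun b => q s b * c b) = (fun=> 0).
  elim: s => [|p s IH].
    by rewrite -[RHS]c0; congr lin_comb; apply/funext => b; rewrite /q big_nil mul1r.
  apply/funext => z; rewrite (_ : lin_comb _ z =
    Dtheta p.1 (lin_comb (fun b => q s b * c b)) z
      - p.2%:R * lin_comb (fun b => q s b * c b) z).
    by rewrite IH mulr0 subr0 /Dtheta (is_cderive_val (is_cderive_cst 0 0)) mulr0.
  rewrite Dtheta_lin_comb /Defs.lin_comb mulr_sumr -sumrB; apply: eq_bigr => b _.
  by rewrite /q big_cons; ring.
pose s := [seq p <- enum {: 'I_m * 'I_N.+1} | p.2 != a p.1].
(* Every monomial is 1 here, so evaluation adds up the coefficients. *)
pose one : point (R := R) m := const_mx 1.
have mon1 b : monomial b one = 1.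
  rewrite /monomial mxE expr1n mul1r big1 // => j _; by rewrite mxE expr1n.
have := congr1 (@^~ one) (q0 s).
rewrite /Defs.lin_comb (bigD1 a) //= mon1 mulr1 big1 ?addr0; last first.
  move=> b /andP[_ /eqP ba]; rewrite mon1 mulr1.
  have [j baj] : exists j, b j != a j.
    apply/existsP; apply: contra_notT ba; rewrite negb_exists => /forallP ba.
    by apply/ffunP => j; apply/eqP; have := ba j; rewrite negbK.
  have bs : (j, b j) \in s by rewrite mem_filter /= baj mem_enum.
  by rewrite /q (big_rem _ bs) /= subrr !mul0r.
move/eqP; rewrite mulf_eq0 => /orP[|/eqP//].
rewrite /q prodf_seq_eq0 => /hasP[p]; rewrite mem_filter => /andP[pa _] /=.
by rewrite subr_eq0 eqr_nat => /eqP ap; rewrite -val_eqE /= ap eqxx in pa.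
Qed.

Lemma lin_combB c d z :
  lin_comb c z - lin_comb d z = lin_comb (fun a => c a - d a) z.
Proof. by rewrite /Defs.lin_comb -sumrB; apply: eq_bigr => a _; rewrite mulrBl. Qed.

Lemma lin_comb_inj c d : lin_comb c = lin_comb d ->
  forall a, (msum a <= N)%N -> c a = d a.
Proof.
move=> cd a aN; apply/eqP; rewrite -subr_eq0; apply/eqP.
apply: (@lin_comb_eq0 (fun a => c a - d a)) => //.
by apply/funext => z; rewrite -lin_combB cd subrr.
Qed.

Lemma fs_inner_lin_comb c d : fs_inner N (lin_comb c) (lin_comb d) =
  \sum_(a : multi_index m N | (msum a <= N)%N) c a * (d a)^* * fs_norm2 a.
Proof.
have coefE e a : (msum a <= N)%N -> mono_coef (lin_comb e) a = e a.
  move=> aN; rewrite /mono_coef; case: xgetP => [e' _ /= ee'|/(_ e) []//].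
  by apply/esym; exact: lin_comb_inj ee' a aN.
by apply: eq_bigr => a aN; rewrite !coefE.
Qed.

End TorusAction.

(** * Functional calculus of the torus generators *)

Section SpectralTheorem.
Context {R : realType} {m N : nat}.
Hypothesis N_gt0 : (0 < N)%N.
Implicit Types (a b : multi_index m N) (c d : multi_index m N -> R[i]).

Local Notation monomial := (@monomial R m N).
Local Notation lin_comb := (@lin_comb R m N).
Local Notation eigenspace := (joint_eigenspace (@H0 R m N)
  (fun j s z => N%:R^-1 * Dtheta j s z)).

Definition weight a : 'rV[R]_m := \row_(j < m) ((a j)%:R / N%:R).

Let N0 : N%:R != 0 :> R. Proof. by rewrite pnatr_eq0 -lt0n. Qed.

Lemma weight_inj : injective weight.
Proof.
move=> a b /rowP ab; apply/ffunP => j; apply/val_inj/eqP => /=.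
rewrite -(eqr_nat R); apply/eqP/(mulIf (invr_neq0 N0)).
by have := ab j; rewrite !mxE.
Qed.

Lemma lin_comb1 a k : (msum a <= N)%N ->
  lin_comb (fun b => if b == a then k else 0) = (fun z => k * monomial a z).
Proof.
move=> aN; apply/funext => z; rewrite /Defs.lin_comb (bigD1 a) //= eqxx.
by rewrite big1 ?addr0 // => b /andP[_ /negbTE ->]; rewrite mul0r.
Qed.

Lemma joint_eigenspace_coef lam c : eigenspace lam (lin_comb c) ->
  forall a, (msum a <= N)%N -> c a != 0 -> weight a = lam.
Proof.
move=> [_ Ec] a aN ca0; apply/rowP => j; rewrite mxE.
have /lin_comb_inj/(_ a aN) : lin_comb (fun a => N%:R^-1 * ((a j)%:R * c a)) =
    lin_comb (fun a => (lam 0 j)%:C * c a).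
  apply/funext => z; have := Ec j z; rewrite Dtheta_lin_comb /Defs.lin_comb !mulr_sumr.
  by under eq_bigr do rewrite mulrA; under [X in _ = X]eq_bigr do rewrite mulrA.
rewrite mulrA => /(mulIf ca0) E; apply: (@complexI R).
by rewrite -E rmorphM fmorphV !rmorph_nat mulrC.
Qed.

(** The joint spectrum is simple: since [weight] is injective, an eigenvector
    with eigenvalue [weight a] has no coefficient other than that of [a]. *)
Lemma joint_eigenspaceP a (s : section m) : (msum a <= N)%N ->
  eigenspace (weight a) s <-> exists k, s = (fun z => k * monomial a z).
Proof.
move=> aN; split=> [sE|[k ->]].
  have [[c _ sc] _] := sE; exists (c a); rewrite -lin_comb1 // -sc; rewrite -sc in sE.
  apply/funext => z; apply: eq_bigr => b bN; case: eqP => [->//|ba].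
  case: (eqVneq (c b) 0) => [->//|cb0]; case: ba; apply: weight_inj.
  exact: joint_eigenspace_coef sE b bN cb0.
rewrite -lin_comb1 //; split; first by eexists.
move=> j z; rewrite Dtheta_lin_comb /Defs.lin_comb !mulr_sumr; apply: eq_bigr => b _.
case: eqP => [->|_]; last by rewrite !(mulr0, mul0r).
by rewrite mxE rmorphM fmorphV !rmorph_nat; ring.
Qed.

Lemma joint_spectrumE : joint_spectrum (@H0 R m N)
    (fun j s z => N%:R^-1 * Dtheta j s z) =
  weight @` [set a | (msum a <= N)%N].
Proof.
apply/seteqP; split=> [lam [s sE [z sz0]]|_ [a aN <-]].
  have [[c _ sc] _] := sE; rewrite -sc in sE sz0.
  have [a /andP[aN ca0]] : exists a, (msum a <= N)%N && (c a != 0).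
    apply/existsP; apply: contraNT sz0; rewrite negb_exists => /forallP c0.
    rewrite /Defs.lin_comb big1 // => a aN; have := c0 a.
    by rewrite aN /= negbK => /eqP ->; rewrite mul0r.
  by exists a => //; exact: joint_eigenspace_coef sE a aN ca0.
exists (fun z => 1 * monomial a z); first by apply/joint_eigenspaceP => //; exists 1.
exists (const_mx 1); rewrite mul1r /Defs.monomial mxE expr1n mul1r.
by rewrite big1 ?oner_eq0 // => j _; rewrite mxE expr1n.
Qed.

Lemma fs_norm2_neq0 a : fs_norm2 a != 0 :> R[i].
Proof.
rewrite /fs_norm2 mulf_neq0 ?invr_neq0 // pnatr_eq0 -lt0n ?fact_gt0 //.
by rewrite muln_gt0 fact_gt0 prodn_gt0 // => j; rewrite fact_gt0.
Qed.

(** The eigenspace is a line, so orthogonality of the remainder to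
    [monomial a] alone fixes the multiple of [monomial a]; the other
    terms of the combination are already orthogonal to it. *)
Lemma orth_proj_lin_comb a c : (msum a <= N)%N ->
  orth_proj (@fs_inner R m N) (eigenspace (weight a)) (lin_comb c) =
  (fun z => c a * monomial a z).
Proof.
move=> aN.
have ipE k l : fs_inner N (fun z => lin_comb c z - k * monomial a z)
    (fun z => l * monomial a z) = (c a - k) * l^* * fs_norm2 a.
  rewrite -(lin_comb1 l aN).
  under [X in fs_inner N X]eq_fun do
    rewrite -[k * _]/((fun z => k * monomial a z) _) -(lin_comb1 k aN) lin_combB.
  rewrite fs_inner_lin_comb (bigD1 a) //= eqxx big1 ?addr0 // => b.
  by move=> /andP[_ /negbTE ->]; rewrite conjC0 mulr0 mul0r.
apply: xget_unique => [|p [] /joint_eigenspaceP[]// k -> orth].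
  split; first by apply/joint_eigenspaceP => //; exists (c a).
  by move=> w /joint_eigenspaceP[]// l ->; rewrite ipE subrr !mul0r.
have := orth (fun z => 1 * monomial a z).
rewrite ipE conjC1 mulr1 => /(_ _)/eqP.
rewrite mulf_eq0 (negbTE (fs_norm2_neq0 a)) orbF subr_eq0 => /(_ _)/eqP -> //.
by apply/joint_eigenspaceP => //; exists 1.
Qed.

(** Indexing the joint spectrum by multi-indices turns the spectral sum into
    the monomial expansion. *)
Lemma f_of_Dtheta_lin_comb (f : 'rV[R]_m -> R[i]) c :
  f_of_Dtheta N f (lin_comb c) = lin_comb (fun a => f (weight a) * c a).
Proof.
apply/funext => z; rewrite /f_of_Dtheta /functional_calculus joint_spectrumE.
rewrite fsbig_image; last by move=> a b _ _; exact: weight_inj.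
rewrite -[RHS](_ : \sum_(a \in [set` [pred a | (msum a <= N)%N]])
    f (weight a) * c a * monomial a z = _); last first.
  by rewrite -(bigfs _ (index_enum_uniq _)) // => a _; rewrite mem_index_enum.
apply: eq_fsbigr => a; rewrite inE /= => aN.
by rewrite orth_proj_lin_comb // mulrA.
Qed.

End SpectralTheorem.

(** * Bernstein weights from the Bergman kernel *)

(** The constant is [1 / ||chi_a||^2] divided by the multinomial coefficient,
    [((N+m)! / ((N-|a|)! a!)) / (N! / ((N-|a|)! a!))], which does not depend on
    [a]; the rest is [|chi_a(z)|^2] written in terms of the [|z_k|^2]. *)
Lemma fs_density_moment_map (R : realType) (m N : nat) (z : point m)
    (a : multi_index m N) (x := moment_map z : 'rV[R]_m) :
  unit_sphere m z ->
  monomial a z * (monomial a z)^* / fs_norm2 a =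
  (N + m)`!%:R / N`!%:R * (multinomial a * (\prod_(j < m) x 0 j ^+ a j)
     * (1 - \sum_(j < m) x 0 j) ^+ (N - msum a))%:C.
Proof.
move=> zS.
have xE j : `|z 0 (lift ord0 j)| ^+ 2 = (x 0 j)%:C.
  by rewrite mxE RRe_real // rpredX ?normr_real.
have x0E : `|z 0 ord0| ^+ 2 = (1 - \sum_(j < m) x 0 j)%:C.
  move: zS; rewrite /unit_sphere /= big_ord_recl => /(canRL (addrK _)) ->.
  rewrite rmorphB rmorph1 rmorph_sum; congr (_ - _).
  by apply: eq_bigr => j _; rewrite xE.
rewrite -normCK /Defs.monomial normrM normrX exprMn exprAC x0E.
rewrite normr_prod -prodrXl (eq_bigr (fun j => (x 0 j)%:C ^+ a j)) => [|j _]; last first.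
  by rewrite normrX exprAC xE.
have fn0 k : k`!%:R != 0 :> R[i] by rewrite pnatr_eq0 -lt0n fact_gt0.
have mf0 : (mfact a)%:R != 0 :> R[i].
  by rewrite pnatr_eq0 -lt0n prodn_gt0 // => j; rewrite fact_gt0.
have multC : (multinomial a)%:C = N`!%:R / ((N - msum a)`! * mfact a)%:R :> R[i].
  by rewrite rmorphM fmorphV !rmorph_nat.
have prodC : (\prod_(j < m) x 0 j ^+ a j)%:C = \prod_(j < m) (x 0 j)%:C ^+ a j.
  by rewrite rmorph_prod; apply: eq_bigr => j _; rewrite rmorphXn.
have -> (p q r : R) : (p * q * r)%:C = p%:C * q%:C * r%:C by rewrite !rmorphM.
rewrite multC prodC rmorphXn /fs_norm2 !natrM.
by field; rewrite !fn0 mf0.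
Qed.

Theorem mainTheorem1 (R : realType) (m N : nat) (hm : (1 <= m)%N)
    (hN : (1 <= N)%N) (f : 'rV[R]_m -> R[i]) (hf : test_function f)
    (x : 'rV[R]_m) (hx : simplex m x)
    (z : 'rV[R[i]]_m.+1) (hz : unit_sphere m z) (hzx : moment_map z = x) :
  bernstein N f x =
    (bergman_kernel m N z z)^-1 *
      f_of_Dtheta N f (fun w => bergman_kernel m N w z) (torus_act 0 z).
Proof.
pose C : R[i] := (N + m)`!%:R / N`!%:R.
have C0 : C != 0 by rewrite mulf_neq0 ?invr_neq0 // pnatr_eq0 -lt0n fact_gt0.
have -> : bergman_kernel m N z z = C.
  rewrite bergman_kernelE.
  under eq_bigr do rewrite fs_density_moment_map //.
  rewrite -mulr_sumr -rmorph_sum hzx.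
  under eq_bigr do rewrite -mulrA.
  by rewrite multinomial_theorem subrK expr1n mulr1.
have -> : (fun w => bergman_kernel m N w z) =
    lin_comb (fun a : multi_index m N => (monomial a z)^* / fs_norm2 a).
  apply/funext => w; rewrite bergman_kernelE; apply: eq_bigr => a _.
  by rewrite -mulrA mulrC.
rewrite f_of_Dtheta_lin_comb // torus_act0 mulr_sumr; apply: eq_bigr => a aN.
have := fs_density_moment_map a hz; rewrite hzx -/C => E.
apply: (mulfI C0); rewrite mulrA -E /weight; field.
by rewrite C0 fs_norm2_neq0.
Qed.
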